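(* For no integer $\Delta\ge4$ is there a finite constant $C_\Delta$ such that \[ \tau_D(G)\le \mathsf{B}_{\mathrm{HY}}(G)+C_\Delta \] for every connected graph $G$ of maximum degree exactly $\Delta$. Hence there is no finite constant $C$ such that $\tau_D(G)\le \mathsf{B}_{\mathrm{HY}}(G)+C$ for every graph $G$; and the inequality $\tau_D(G)\le\lceil \mathsf{B}_{\mathrm{HY}}(G)\rceil$ does not hold for all graphs $G$, i.e. there is a graph $G$ with $\tau_D(G)>\lceil \mathsf{B}_{\mathrm{HY}}(G)\rceil$.
   Context: All graphs are finite, simple and undirected. A set $T\subseteq V(G)$ is an identifying vertex cover if $e\cap T\neq\emptyset$ for every $e\in E(G)$ and the sets $e\cap T$ ($e\in E(G)$) are pairwise distinct; $\tau_D(G)$ is the minimum cardinality of an identifying vertex cover of $G$. For a graph $G$ of order $n$, size $m$ and maximum degree $\Delta$, \[ \mathsf{B}_{\mathrm{HY}}(G)=\frac{\Delta(\Delta-1)n+2m}{\Delta^2+1}. \] *)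

(* Defs.v *)
From HB Require Import structures.
From mathcomp Require Import all_boot all_order all_algebra.
From mathcomp Require Import reals.

Set Implicit Arguments.
Unset Strict Implicit.
Unset Printing Implicit Defensive.

Import Order.TTheory GRing.Theory Num.Theory.

Record sgraph := SGraph {
  vertex :> finType;
  adj : rel vertex;
  adj_sym : symmetric adj;
  adj_irr : irreflexive adj }.

Definition edges (G : sgraph) : {set {set G}} :=
  [set [set p.1; p.2] | p in [pred p : G * G | adj p.1 p.2]].

Definition gorder (G : sgraph) : nat := #|G|.

Definition gsize (G : sgraph) : nat := #|edges G|.

Definition degree (G : sgraph) (x : G) : nat := #|[set y | adj x y]|.

Definition max_degree (G : sgraph) : nat := \max_(x : G) degree x.

(* The graph with no vertices is not connected. *)
Definition connected (G : sgraph) : bool :=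
  (0 < #|G|) && [forall x : G, forall y : G, connect (@adj G) x y].

Definition identifying_vertex_cover (G : sgraph) (A : {set G}) : bool :=
  [forall e in edges G, e :&: A != set0] &&
  [forall e in edges G, forall f in edges G,
     (e != f) ==> (e :&: A != f :&: A)].

Definition tau_D (G : sgraph) : nat :=
  #|[arg min_(A < [set: G] | identifying_vertex_cover A) #|A|]|.

Lemma identifying_vertex_coverT (G : sgraph) :
  identifying_vertex_cover [set: G].
Proof.
apply/andP; split; last first.
  by apply/forall_inP => e _; apply/forall_inP => f _; rewrite !setIT; apply/implyP.
apply/forall_inP => e /imsetP [p _ ->]; rewrite setIT.
by apply/set0Pn; exists p.1; rewrite !inE eqxx.
Qed.

Lemma tau_D_min (G : sgraph) (A : {set G}) :
  identifying_vertex_cover A -> tau_D G <= #|A|.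
Proof.
rewrite /tau_D; case: arg_minnP => [|B _]; first exact: identifying_vertex_coverT.
exact.
Qed.

Lemma tau_D_attained (G : sgraph) :
  exists2 A : {set G}, identifying_vertex_cover A & #|A| = tau_D G.
Proof.
rewrite /tau_D; case: arg_minnP => [|B hB _]; first exact: identifying_vertex_coverT.
by exists B.
Qed.

Local Open Scope ring_scope.

Definition B_HY (R : realType) (G : sgraph) : R :=
  let D : R := (max_degree G)%:R in
  (D * (D - 1) * (gorder G)%:R + 2 * (gsize G)%:R) / (D ^+ 2 + 1).

(* Main.v *)
Require Import Defs.
From mathcomp Require Import all_boot all_order all_algebra.
From mathcomp Require Import reals.
From mathcomp Require Import zify lra.

(**
The complement of an identifying vertex cover is a 2-packing (a set of vertices
at pairwise distance at least 3), so a graph of order [n] whose vertices are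
covered by [k] sets of diameter at most 2 has [tau_D >= n - k].  The Petersen
graph has diameter 2, and this persists when one of its vertices is replaced by
[d + 1] twins, where [d = Delta - 4].  Linking [k] such blocks into a chain
gives a connected graph of maximum degree [Delta] with [n = k (d + 10)] and
[2 m <= k (6 d + 32)]; hence [(Delta ^ 2 + 1) (n - k - B_HY) >= k (d + 1)], and
[tau_D - B_HY] is unbounded in [k].
*)

Set Implicit Arguments.
Unset Strict Implicit.
Unset Printing Implicit Defensive.

Import Order.TTheory GRing.Theory Num.Theory.

Local Open Scope nat_scope.

(** * Covers and edge counts in arbitrary graphs *)

Section GeneralGraphs.

Variable G : sgraph.
Implicit Types (x y z : G) (A : {set G}).

Lemma edge_in x y : adj x y -> [set x; y] \in edges G.
Proof. by move=> xy; apply/imsetP; exists (x, y). Qed.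

Lemma ivc_adj A x y :
  identifying_vertex_cover A -> adj x y -> x \notin A -> y \in A.
Proof.
case/andP=> /forall_inP cov _ xy xA; have /set0Pn[z] := cov _ (edge_in xy).
by rewrite !inE => /andP[/orP[]/eqP-> //]; rewrite (negPf xA).
Qed.

(** Both edges at [z] leave the same trace [[set z]] on [A], so they must be the same edge. *)
Lemma ivc_common_neighbor A x y z :
    identifying_vertex_cover A -> adj x z -> adj z y ->
  x \notin A -> y \notin A -> x = y.
Proof.
move=> covA xz zy xA yA; have zA := ivc_adj covA xz xA.
have trace t : t \notin A -> [set t; z] :&: A = [set z].
  move=> tA; apply/setP=> w; rewrite !inE.
  by have [->|_] := eqVneq w z; rewrite ?orbT ?zA // orbF;
     have [->|//] := eqVneq w t; rewrite (negPf tA).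
apply/eqP; apply: contraT => nxy.
case/andP: covA => _ /forall_inP/(_ _ (edge_in xz))/forall_inP.
rewrite adj_sym in zy; move/(_ _ (edge_in zy)).
rewrite !trace // eqxx implybF negbK.
move/eqP/setP/(_ x); rewrite !inE eqxx (negPf nxy) /= => /esym/eqP xz_eq.
by rewrite xz_eq adj_irr in xz.
Qed.

(** The fibres of [f] are sets of diameter at most 2, so [f] is injective on the complement of a
    minimum cover. For [x = y] the hypothesis asks that [x] have a neighbour. *)
Lemma order_leq_tau_D (I : finType) (f : G -> I) :
    (forall x y, f x = f y -> adj x y \/ exists2 z, adj x z & adj z y) ->
  gorder G <= tau_D G + #|I|.
Proof.
move=> diam2; have [A covA <-] := tau_D_attained G.
rewrite /gorder -(cardsC A) leq_add2l.
have inj : {in ~: A &, injective f}.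
  move=> x y; rewrite !inE => xA yA /diam2[xy|[z xz zy]].
    by rewrite (ivc_adj covA xy xA) in yA.
  exact: ivc_common_neighbor covA xz zy xA yA.
by rewrite -(card_in_imset inj) max_card.
Qed.

(** The degree sum counts ordered adjacent pairs, and each edge comes from at least the two pairs
    [(x, y)] and [(y, x)]. *)
Lemma double_gsize_leq : 2 * gsize G <= \sum_(x : G) degree x.
Proof.
have -> : \sum_(x : G) degree x =
          \sum_(p in [pred p : G * G | adj p.1 p.2]) 1.
  rewrite -(pair_big_dep xpredT (fun x y => adj x y) (fun _ _ => 1)) /=.
  by apply: eq_bigr => x _; rewrite sum1dep_card.
rewrite (partition_big_imset (fun p : G * G => [set p.1; p.2])) /=.
rewrite mulnC /gsize -sum_nat_const; apply: leq_sum => _ /imsetP[[x y] xy ->].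
rewrite sum1_card; rewrite inE /= in xy.
have nxy : x != y by apply: contraTneq xy => ->; rewrite adj_irr.
have <- : #|[set (x, y); (y, x)]| = 2.
  by rewrite cards2 xpair_eqE (negPf nxy).
apply/subset_leq_card/subsetP => p; rewrite !inE.
by case/orP=> /eqP->; rewrite unfold_in inE /= ?xy ?eqxx // adj_sym xy setUC eqxx.
Qed.

End GeneralGraphs.

(** Clears the denominator of [B_HY]: the coefficient of the order becomes
    [(D ^ 2 + 1) - D * (D - 1) = D + 1]. *)
Lemma gap_B_HY (R : realType) (G : sgraph) (k e : nat) :
    let D := max_degree G in
    gorder G <= tau_D G + k ->
    2 * gsize G + k * (D ^ 2 + 1) + e <= (D + 1) * gorder G ->
  (e%:R <= ((tau_D G)%:R - B_HY R G) * (D%:R ^+ 2 + 1))%R.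
Proof.
move=> D; rewrite -(ler_nat R) => n_le; rewrite -(ler_nat R) => me_le.
move: n_le me_le; rewrite /B_HY -/D !(natrD, natrM, natrX) => n_le me_le.
have pos : (0 < (D%:R : R) ^+ 2 + 1)%R by rewrite ltr_wpDl ?sqr_ge0.
rewrite mulrBl divfK ?gt_eqF //.
have := ler_wpM2r (ltW pos) n_le; lra.
Qed.

(** * Chains of Petersen blocks with twins *)

Section BlockChain.

(** Outer cycle, spokes and inner pentagram, each edge in one direction. *)
Definition petersen_arcs : seq (nat * nat) :=
  [:: (0, 1); (1, 2); (2, 3); (3, 4); (4, 0);
      (0, 5); (1, 6); (2, 7); (3, 8); (4, 9);
      (5, 7); (6, 8); (7, 9); (8, 5); (9, 6)].

Definition petersen (p q : nat) : bool :=
  ((p, q) \in petersen_arcs) || ((q, p) \in petersen_arcs).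

Lemma petersen_sym : symmetric petersen.
Proof. by move=> p q; rewrite /petersen orbC. Qed.

Lemma petersen_diam2 p q : p < 10 -> q < 10 ->
  petersen p q \/ exists w, [/\ w < 10, petersen p w & petersen w q].
Proof.
move=> p10 q10.
(* Evaluation over all 100 pairs; for [p = q] the walk goes to a neighbour and back. *)
have /allP/(_ p)/[!mem_iota]/(_ p10)/allP/(_ q)/[!mem_iota]/(_ q10) :
  all (fun p => all (fun q => petersen p q ||
    has (fun w => petersen p w && petersen w q) (iota 0 10)) (iota 0 10))
    (iota 0 10) by vm_compute.
case/orP=> [|/hasP[w]]; first by left.
by rewrite mem_iota => w10 /andP[pw wq]; right; exists w.
Qed.

Lemma petersen_cubic p : p < 10 -> \sum_(q < 10) petersen p q = 3.
Proof.
by rewrite !big_ord_recr big_ord0 /=; do 10?[case: p => [//|p]].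
Qed.

Variables d k : nat.

(* The vertices [9, ..., 9 + d] of a block are the twins of Petersen vertex 9,
   whose neighbours are 4, 6 and 7. *)
Definition block := 'I_(9 + d.+1).

Definition base (u : nat) : nat := minn u 9.

Lemma base_lt u : base u < 10.
Proof. by rewrite /base ltnS geq_minr. Qed.

Lemma base_id u : u < 10 -> base u = u.
Proof. by rewrite ltnS => /minn_idPl. Qed.

(** The fibre of [base] over 9 consists of the [d.+1] twins; one of them is counted in the sum over
    [q < 10]. *)
Lemma sum_block (F : nat -> nat) :
  \sum_(u : block) F (base u) = \sum_(q < 10) F q + d * F 9.
Proof.
rewrite big_split_ord [X in _ = X + _]big_ord_recr /= -addnA; congr (_ + _).
  by apply: eq_bigr => i _; rewrite base_id // ltnW // ltnS.
under eq_bigr => i _ do rewrite /base (minn_idPr _) ?leq_addr //.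
by rewrite sum_nat_const card_ord mulSn.
Qed.

Lemma card_block_nbr p : p < 10 ->
  #|[set v : block | petersen p (base v)]| = 3 + d * petersen p 9.
Proof.
move=> p10; rewrite -sum1dep_card big_mkcond /=.
under eq_bigr => v _ do rewrite -[if _ then _ else _]/(nat_of_bool _).
by rewrite (sum_block (petersen p)) petersen_cubic.
Qed.

(* At least two blocks: without a link, vertex 4 has degree only [d + 3]. *)
Definition chain_vertex := ('I_k.+2 * block)%type.

(** Vertices 4 and 6 are neighbours of all twins, so each has [d + 3] neighbours in its block; as
    they are distinct, each gains at most one link and the degree stays within [d + 4]. *)
Definition link (x y : chain_vertex) : bool :=
  [&& x.1.+1 == y.1 :> nat, x.2 == 4 :> nat & y.2 == 6 :> nat].

Definition chain_adj : rel chain_vertex := fun x y =>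
  [|| (x.1 == y.1) && petersen (base x.2) (base y.2), link x y | link y x].

Lemma chain_adj_sym : symmetric chain_adj.
Proof.
by move=> x y; rewrite /chain_adj eq_sym petersen_sym [link x y || _]orbC.
Qed.

Lemma chain_adj_irr : irreflexive chain_adj.
Proof.
move=> x; rewrite /chain_adj /link gtn_eqF // eqxx /= orbF.
by have := base_lt x.2; move: (base _); do 10!case=> [|] //.
Qed.

Definition chain : sgraph := SGraph chain_adj_sym chain_adj_irr.

Lemma gorder_chain : gorder chain = k.+2 * (d + 10).
Proof. by rewrite /gorder card_prod !card_ord; lia. Qed.

Lemma chain_diam2 (x y : chain) : x.1 = y.1 ->
  adj x y \/ exists2 z : chain, adj x z & adj z y.
Proof.
case: x y => [i u] [_ v] /= <-; rewrite /chain_adj /= eqxx.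
case: (petersen_diam2 (base_lt u) (base_lt v)) => [->|[w [w10 uw wv]]].
  by left.
have wd : w < 9 + d.+1 by lia.
right; exists ((i, Ordinal wd) : chain).
  by rewrite /chain_adj /= eqxx (base_id w10) uw.
by rewrite /chain_adj /= eqxx (base_id w10) wv.
Qed.

(** Neighbours in the block, then the outgoing and the incoming link; only a bound, because each end
    block lacks one link. *)
Definition chain_degree_bound (u : nat) : nat :=
  3 + d * petersen u 9 + (u == 4) + (u == 6).

Lemma card_link_out (x : chain) :
  #|[set y : chain | link x y]| <= (base x.2 == 4).
Proof.
case: x => i u; have [u4|u4] := eqVneq (base u) 4.
  apply/card_le1_eqP => -[j v] [j' v']; rewrite !inE /link /=.
  move=> /and3P[/eqP ij _ /eqP v6] /and3P[/eqP ij' _ /eqP v6'].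
  by congr pair; apply: val_inj => /=; congruence.
rewrite leqn0 cards_eq0; apply/eqP/setP => y; rewrite !inE /link /=.
by apply: contra_neqF u4 => /and3P[_ /eqP-> _].
Qed.

Lemma card_link_in (x : chain) :
  #|[set y : chain | link y x]| <= (base x.2 == 6).
Proof.
case: x => i u; have [u6|u6] := eqVneq (base u) 6.
  apply/card_le1_eqP => -[j v] [j' v']; rewrite !inE /link /=.
  move=> /and3P[/eqP ij /eqP v4 _] /and3P[/eqP ij' /eqP v4' _].
  by congr pair; apply: val_inj => /=; congruence.
rewrite leqn0 cards_eq0; apply/eqP/setP => y; rewrite !inE /link /=.
by apply: contra_neqF u6 => /and3P[_ _ /eqP->].
Qed.

Lemma card_block_part (i : 'I_k.+2) (u : block) :
  #|[set (i, v) | v in [set v : block | petersen (base u) (base v)]]|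
    = 3 + d * petersen (base u) 9.
Proof. by rewrite card_imset ?card_block_nbr ?base_lt // => v w []. Qed.

Lemma degree_chain (x : chain) : degree x <= chain_degree_bound (base x.2).
Proof.
case: x => i u; rewrite /degree /chain_degree_bound.
set B := [set (i, v) | v in [set v : block | petersen (base u) (base v)]].
apply: leq_trans (_ : #|B :|: [set y : chain | link (i, u) y]
                          :|: [set y : chain | link y (i, u)]| <= _).
  apply/subset_leq_card/subsetP => -[j v]; rewrite !inE /= /chain_adj /=.
  case/or3P=> [/andP[/eqP<- uv]|->|->]; rewrite ?orbT //.
  by rewrite imset_f // inE.
rewrite -(card_block_part i); apply: leq_trans (leq_card_setU _ _) _.
apply: leq_add (card_link_in _); apply: leq_trans (leq_card_setU _ _) _.
exact: leq_add (card_link_out _).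
Qed.

Lemma chain_degree_bound_leq u : u < 10 -> chain_degree_bound u <= d + 4.
Proof.
by rewrite /chain_degree_bound; do 10?[case: u => [_|u] /=; first lia].
Qed.

Lemma max_degree_chain : max_degree chain = d + 4.
Proof.
apply/eqP; rewrite eqn_leq; apply/andP; split.
  apply/bigmax_leqP => x _; apply: leq_trans (degree_chain x) _.
  by rewrite chain_degree_bound_leq ?base_lt.
have lt4 : 4 < 9 + d.+1 by [].
have lt6 : 6 < 9 + d.+1 by [].
pose u : block := Ordinal lt4; pose v : block := Ordinal lt6.
pose j : 'I_k.+2 := lift ord0 ord0.
(* Vertex 4 of the first block attains the maximum: [B] is its neighbourhood in the block, and
   [(j, v)] is the end of its link. *)
apply: leq_trans (leq_bigmax ((ord0, u) : chain)).
set B := [set (ord0 : 'I_k.+2, w) | w in [set w : block | petersen 4 (base w)]].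
apply: leq_trans (_ : #|(j, v) |: B| <= _).
  rewrite cardsU1 (card_block_part ord0 u) /=.
  suff -> : (j, v) \notin B by lia.
  by apply/negP => /imsetP[w _ /(congr1 (fun y => val y.1))].
apply/subset_leq_card/subsetP => y; rewrite !inE /= /chain_adj.
case/orP=> [/eqP->|/imsetP[w]]; first by [].
by rewrite inE => uw ->; rewrite /= uw.
Qed.

Lemma gsize_chain : 2 * gsize chain <= k.+2 * (6 * d + 32).
Proof.
apply: leq_trans (double_gsize_leq chain) _.
apply: leq_trans (_ : \sum_(x : chain) chain_degree_bound (base x.2) <= _).
  by apply: leq_sum => x _; apply: degree_chain.
rewrite -(pair_bigA _ (fun _ (u : block) => chain_degree_bound (base u))) /=.
(* Per block, the ten Petersen vertices contribute [30 + 3 * d + 2] and the [d] further twins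
   [3 * d]. *)
rewrite sum_nat_const card_ord leq_mul2l /= sum_block.
rewrite !big_ord_recr big_ord0 /= /chain_degree_bound /=.
rewrite /petersen /=; lia.
Qed.

Lemma chain_connected : connected chain.
Proof.
have csym := sym_connect_sym chain_adj_sym.
apply/andP; split; first by rewrite [#|_|]gorder_chain; lia.
have same i (u v : block) : connect chain_adj (i, u) (i, v).
  have [uv|[z uz zv]] := @chain_diam2 (i, u) (i, v) erefl.
    exact: connect1.
  exact: connect_trans (connect1 uz) (connect1 zv).
have lt4 : 4 < 9 + d.+1 by [].
have lt6 : 6 < 9 + d.+1 by [].
pose o : chain_vertex := (ord0, Ordinal lt4).
have reach m (lt_m : m < k.+2) u : connect chain_adj o (Ordinal lt_m, u).
  elim: m lt_m u => [|m IHm] lt_m u.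
    by rewrite (_ : Ordinal lt_m = ord0) ?same //; apply: val_inj.
  (* Leave block [m] at vertex 4, enter the next block at vertex 6, then move inside it. *)
  apply: connect_trans (IHm (ltnW lt_m) (Ordinal lt4)) _.
  apply: connect_trans (same _ (Ordinal lt6) _).
  by apply: connect1; rewrite /chain_adj /link /= eqxx orbT.
apply/forallP => -[[i lt_i] u]; apply/forallP => -[[j lt_j] v].
by apply: connect_trans (reach _ _ _); rewrite csym.
Qed.

Lemma chain_gap (R : realType) :
  ((k.+2 * (d + 1))%:R <=
     ((tau_D chain)%:R - B_HY R chain) * ((d + 4)%:R ^+ 2 + 1))%R.
Proof.
rewrite -max_degree_chain; apply: (@gap_B_HY R chain k.+2).
  rewrite -[X in _ + X](card_ord k.+2); exact: (order_leq_tau_D chain_diam2).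
rewrite max_degree_chain gorder_chain.
(* With [D = d + 4], the count per block is the identity [(6 * d + 32) + (D ^ 2 + 1) + (d + 1) = (D
   + 1) * (d + 10)]. *)
have := gsize_chain; nia.
Qed.

End BlockChain.

(** * Long chains exceed every additive constant *)

Lemma unbounded_gap (R : realType) (Delta : nat) (C : R) : 4 <= Delta ->
  exists G : sgraph, [/\ connected G, max_degree G = Delta &
    (B_HY R G + C < (tau_D G)%:R)%R].
Proof.
move=> /subnK <-; set d := Delta - 4.
pose Q : R := ((d + 4)%:R ^+ 2 + 1)%R.
have Q0 : (0 < Q)%R by rewrite ltr_wpDl ?sqr_ge0.
(* The gap times [Q] is at least [k.+2 * (d + 1)], so it is enough that [k] exceed [C * Q]. *)
pose k := Num.bound `|C * Q|%R.
exists (chain d k); split; [exact: chain_connected|exact: max_degree_chain|].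
rewrite addrC -ltrBrDr -(ltr_pM2r Q0).
apply: lt_le_trans (chain_gap d k R).
apply: le_lt_trans (ler_norm _) _; apply: lt_le_trans (archi_boundP _) _ => //.
by rewrite ler_nat -/k; nia.
Qed.

Local Open Scope ring_scope.

Theorem corollary4p7 (R : realType) :
  [/\ forall Delta : nat, (4 <= Delta)%N ->
        ~ exists C : R, forall G : sgraph,
            connected G -> max_degree G = Delta ->
            (tau_D G)%:R <= B_HY R G + C,
      ~ exists C : R, forall G : sgraph, (tau_D G)%:R <= B_HY R G + C
    & exists G : sgraph, Num.ceil (B_HY R G) < (tau_D G)%:Z].
Proof.
split.
- move=> Delta hD [C HC]; have [G [cG mG]] := unbounded_gap C hD.
  by rewrite ltNge HC.
- case=> C HC; have [G [_ _]] := @unbounded_gap R 4 C isT.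
  by rewrite ltNge HC.
(* The constant 1 suffices, since the ceiling of [B_HY R G] is below [B_HY R G + 1]. *)
- have [G [_ _ gap]] := @unbounded_gap R 4 1 isT; exists G.
  rewrite -(ltr_int R); apply: lt_trans gap.
  by rewrite -ltrBlDr; have := ceilB1_lt (B_HY R G); rewrite rmorphB.
Qed.
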